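(* Consider one-dimensional (1D) hierarchical heavy hitter (HHH) detection with the MVPipe data structure and its operations Update and Detect (defined in the context), configured with $\tfrac{2}{\epsilon}$ buckets per array on average and with $t=\log_2\tfrac1\delta$, where $0<\epsilon\le\phi<1$ and $0<\delta<1$, and assume $H\ge\log_2\tfrac1\delta$. Then: 1. MVPipe finds HHHs in $O\!\left(\tfrac{H}{\epsilon}\log n\right)$ space; 2. the update time (per packet) is $O(H)$; 3. the detection time is $O\!\left(\tfrac{H(d-1)}{\epsilon}\log\tfrac1\delta\right)$. (The space and time complexities are implicitly related to the error probability $\delta$, since $H\ge\log_2\tfrac1\delta$ is assumed.)
   Context: **Hierarchy.** A 1D hierarchy has depth $d$, with levels $0,1,\dots,d-1$, and $H$ nodes. In 1D each node is a distinct level, so the levels are $0,\dots,H-1$. Keys at level 0 are flows (e.g. source IP addresses). Each key at a level below the top has a unique generalization at the next level (e.g. $1.2.3.4\mapsto1.2.3.*$), and the top level is the most general aggregate (all addresses). ''Generalize $x$ at level $i$'' means: take the ancestor of $x$ at level $i$ (or $x$ itself if it is at level $i$). Write $x\prec y$ if $x$ can be generalized to $y$, $y\ne x$. Each key is represented in $\log n$ bits, where $n$ is the maximum value of a key. **Stream.** A stream of packets $(f,v_f)$, with $f$ a flow and $v_f$ either 1 (packet counting) or the packet size (byte counting). $\mathcal S$ is the total count of all flows. $\phi$ is the fractional threshold for HHHs, $\epsilon$ the approximation parameter and $\delta$ the error probability. **Data structure.** There are $H$ arrays $A_0,\dots,A_{H-1}$, one per node. Array $A_i$ has $w_i$ buckets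 $B(i,j)$, $0\le j<w_i$. Pairwise-independent hash functions $h_0,\dots,h_{H-1}$ are used, where $h_i$ maps level-$i$ keys to the $w_i$ buckets of $A_i$. Each bucket has four fields: a key $K_{i,j}$ (the candidate HHH) and three counters, namely $V_{i,j}$ (total count hashed to the bucket), $I_{i,j}$ (indicator counter) and $C_{i,j}$ (cumulative count of the candidate since it was stored). Initially all counters are 0 and no key is stored. **Push$(\text{key},\text{value},l)$.** Set $(x,v_x)\leftarrow(\text{key},\text{value})$. For $i=l,\dots,H-1$: replace $x$ by its generalization at level $i$; let $j=h_i(x)$; add $v_x$ to $V_{i,j}$. Then: - if $K_{i,j}=x$: add $v_x$ to $I_{i,j}$ and to $C_{i,j}$, and return; - else if $I_{i,j}\ge v_x$: subtract $v_x$ from $I_{i,j}$; - else: set $I_{i,j}\leftarrow v_x-I_{i,j}$ and swap $(K_{i,j},C_{i,j})$ with $(x,v_x)$. In the last two cases the loop continues with the current $(x,v_x)$. **Update$(f,v_f)$.** Call Push$(f,v_f,0)$; done for each incoming packet. **Estimate$(x,l,t)$.** Set $U_l=(V_{l,h_l(x)}+I_{l,h_l(x)})/2$ and $v=C_{l,h_l(x)}$. For $i=l+1,\dots,\min\{l+t,H-1\}$: let $y$ be the generalization of $x$ at level $i$ and $j=h_i(y)$. If $K_{i,j}=y$, set $U_i=(V_{i,j}+I_{i,j})/2+v$ and then $v\leftarrow v+C_{i,j}$; otherwise set $U_i=(V_{i,j}-I_{i,j})/2+v$. Return $\min_{l\le i\le\min\{l+t,H-1\}}U_i$. **Detect** (run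 at the end of the epoch). Let $\mathcal H_{-1}=\emptyset$. For $i=0,\dots,H-1$: for $j=0,\dots,w_i-1$, let $x=K_{i,j}$ and $\hat S_{\mathcal H_{i-1}}(x)=$ Estimate$(x,i,t)$. If $\hat S_{\mathcal H_{i-1}}(x)>\phi\mathcal S$, report $x$ as an HHH with estimated count $\hat S(x)=\hat S_{\mathcal H_{i-1}}(x)+\sum_{x'\in\mathcal H_{i-1},\,x'\prec x}C_{i',h_{i'}(x')}$, where $i'$ is the level of $x'$; otherwise call Push$(x,C_{i,j},i+1)$. After all $j$, let $\mathcal H_i$ be $\mathcal H_{i-1}$ together with the keys reported at level $i$. Return $\mathcal H_{H-1}$ (with the estimated counts). Update time is the time of one Update operation; detection time is the time of the Detect operation.
   Formalization: Space is counted in bits (hash seeds not charged) and assumes n ≥ 2 and total count S ≤ n^κ for a fixed κ (constant depends on κ), as counters otherwise exceed O(log n) bits; detection time assumes d ≥ 2, as the bound is 0 for d = 1; t is an integer. *)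

(* Defs.v *)
From mathcomp Require Import all_boot all_order all_algebra.
From mathcomp Require Import reals exp.

Set Implicit Arguments.
Unset Strict Implicit.
Unset Printing Implicit Defensive.

Import Order.TTheory GRing.Theory Num.Theory.

(* Keys of all levels live in one type: 1.2.3.4 and 1.2.3.* are different keys.
   [key_value] is the numerical representation of a key.  The value of [parent] at
   the top key is irrelevant. *)
Record hierarchy := Hierarchy {
  depth : nat;
  key : finType;
  key_value : key -> nat;
  level : key -> nat;
  parent : key -> key;
  top_key : key;
  key_value_inj : injective key_value;
  level_lt : forall x, level x < depth;
  level_parent : forall x, (level x).+1 < depth -> level (parent x) = (level x).+1;
  level_top : forall x, ((level x).+1 == depth) = (x == top_key)
}.

(* In one dimension the nodes are exactly the levels 0, ..., depth - 1. *)
Definition nodes (G : hierarchy) : nat := depth G.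

Definition max_key (G : hierarchy) : nat := \max_(x : key G) key_value x.

(* Meaningful for [level x <= i]. *)
Definition gen (G : hierarchy) (i : nat) (x : key G) : key G :=
  iter (i - level x) (@parent G) x.

(* For each level i, [hash_of] is a pairwise independent family of functions
   from the level-i keys to {0, ..., width i - 1}, indexed by a uniformly
   distributed seed; [draw] is an arbitrary outcome of the choice of the seeds.
   Independence reads P[h(x) = a and h(y) = b] = 1 / (width i)^2, multiplied out.
   [lookahead] is the number t of further levels inspected by an estimation. *)
Record mvpipe (G : hierarchy) := MVPipe {
  width : nat -> nat;
  lookahead : nat;
  seed : nat -> finType;
  hash_of : forall i, seed i -> key G -> nat;
  draw : forall i, seed i;
  hash_of_lt : forall i (s : seed i) x,
    i < nodes G -> level x = i -> hash_of s x < width i;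
  hash_of_indep : forall i (x y : key G) a b,
    i < nodes G -> level x = i -> level y = i -> x != y ->
    a < width i -> b < width i ->
    #|[set s : seed i | (hash_of s x == a) && (hash_of s y == b)]| * width i ^ 2
      = #|seed i|
}.

Definition hash (G : hierarchy) (P : mvpipe G) (i : nat) (x : key G) : nat :=
  hash_of (draw P i) x.

Record bucket (G : hierarchy) := Bucket {
  bK : option (key G);
  bV : nat;
  bI : nat;
  bC : nat
}.

(* [arr m i j] is the bucket B(i, j).  [rep m] lists the keys reported so far
   with their estimated counts.  [acc m] is a working array used by Detect. *)
Record memory (G : hierarchy) := Memory {
  arr : nat -> nat -> bucket G;
  rep : seq (key G * nat);
  acc : nat -> nat
}.

Definition empty_memory (G : hierarchy) : memory G :=
  Memory (fun _ _ => Bucket None 0 0 0) [::] (fun _ => 0).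

(* Number of binary digits; 1 for m = 0. *)
Definition nbits (m : nat) : nat := (trunc_log 2 m).+1.

Section Programs.
Context {G : hierarchy} (P : mvpipe G).
Implicit Types (m : memory G) (x y : key G) (i j l v : nat).

Local Notation H := (nodes G).
Local Notation w := (width P).

Definition max_width : nat := \max_(i < H) w i.

Definition max_count m : nat :=
  maxn (\max_(i < H) \max_(j < w i)
          maxn (bV (arr m i j)) (maxn (bI (arr m i j)) (bC (arr m i j))))
       (maxn (\max_(j < max_width) acc m j) (\max_(r <- rep m) r.2)).

(* Bits occupied by a memory state.  A key takes [nbits (max_key G)] bits, plus
   in a bucket one bit telling whether a key is stored.  All counters have the
   same width, that of the largest count present. *)
Definition footprint m : nat :=
  let kw := nbits (max_key G) in
  let cw := nbits (max_count m) in
  (\sum_(i < H) w i) * (kw.+1 + 3 * cw) + max_width * cw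
    + size (rep m) * (kw + cw).

(* Programs over the memory, with the number of elementary operations executed
   and the largest footprint over all memory states passed through. *)
Record outcome (A : Type) := Outcome {
  result : A;
  final : memory G;
  cost : nat;
  peak : nat
}.

Definition prog (A : Type) := memory G -> outcome A.

Definition ret A (a : A) : prog A := fun m => Outcome a m 0 (footprint m).

Definition bind A B (p : prog A) (f : A -> prog B) : prog B := fun m =>
  let r := p m in
  let r' := f (result r) (final r) in
  Outcome (result r') (final r') (cost r + cost r') (maxn (peak r) (peak r')).

Local Notation "'let!' z ':=' p 'in' q" := (bind p (fun z => q))
  (at level 200, z name, p at level 200, q at level 200).
Local Notation "p ;; q" := (bind p (fun _ => q)) (at level 199, right associativity).

(* Elementary operations, of cost 1: generalizing a key, hashing a key, one
   memory access, one loop iteration.  The arithmetic and the comparisons on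
   O(1) words between two of them are subsumed. *)
Definition op A (a : A) : prog A := fun m => Outcome a m 1 (footprint m).
Definition read A (f : memory G -> A) : prog A :=
  fun m => Outcome (f m) m 1 (footprint m).
Definition write (f : memory G -> memory G) : prog unit :=
  fun m => Outcome tt (f m) 1 (maxn (footprint m) (footprint (f m))).

Definition get_bucket i j : prog (bucket G) := read (fun m => arr m i j).
Definition set_bucket i j (b : bucket G) : prog unit :=
  write (fun m => Memory (fun i' j' => if (i' == i) && (j' == j) then b else arr m i' j')
                      (rep m) (acc m)).
Definition get_acc j : prog nat := read (fun m => acc m j).
Definition set_acc j v : prog unit :=
  write (fun m => Memory (arr m) (rep m) (fun j' => if j' == j then v else acc m j')).
Definition report x v : prog unit :=
  write (fun m => Memory (arr m) (rcons (rep m) (x, v)) (acc m)).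
Definition clear_reports : prog unit :=
  write (fun m => Memory (arr m) [::] (acc m)).

Fixpoint for_each A (s : seq A) (body : A -> prog unit) : prog unit :=
  if s is a :: s' then op tt ;; body a ;; for_each s' body else ret tt.

Definition levels_from l : seq nat := iota l (H - l).

(* When the pair swapped out of a bucket is the empty one there is nothing left
   to push, and the loop stops. *)
Fixpoint push_loop (ls : seq nat) x v : prog unit :=
  if ls is i :: ls' then
    op tt ;;
    let! x := op (gen i x) in
    let! j := op (hash P i x) in
    let! b := get_bucket i j in
    if bK b == Some x then
      set_bucket i j (Bucket (bK b) (bV b + v) (bI b + v) (bC b + v))
    else if v <= bI b then
      set_bucket i j (Bucket (bK b) (bV b + v) (bI b - v) (bC b)) ;;
      push_loop ls' x v
    else
      set_bucket i j (Bucket (Some x) (bV b + v) (v - bI b) v) ;;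
      if bK b is Some y then push_loop ls' y (bC b) else ret tt
  else ret tt.

Definition push x v l : prog unit := push_loop (levels_from l) x v.

Definition update (p : key G * nat) : prog unit := push p.1 p.2 0.

(* The halvings are exact: Push preserves I <= V and the equality of the parities
   of I and V.  [lo] is the minimum of the U_i computed so far. *)
Fixpoint estimate_loop (ls : seq nat) x v lo : prog nat :=
  if ls is i :: ls' then
    op tt ;;
    let! y := op (gen i x) in
    let! j := op (hash P i y) in
    let! b := get_bucket i j in
    if bK b == Some y then
      estimate_loop ls' x (v + bC b) (minn lo ((bV b + bI b)./2 + v))
    else
      estimate_loop ls' x v (minn lo ((bV b - bI b)./2 + v))
  else ret lo.

Definition estimate x l t : prog nat :=
  let! j := op (hash P l x) in
  let! b := get_bucket l j in
  estimate_loop (iota l.+1 (minn (l + t) H.-1 - l)) x (bC b) ((bV b + bI b)./2).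

(* Executed when the reported keys are those of the levels below i.  Afterwards,
   for each bucket B(i, j) storing a key x, acc j is the sum of
   C_{i', h_{i'}(x')} over the reported x' generalizing to x, i' being the level
   of x'.  The array A_i does not change while level i is processed. *)
Definition gather i : prog unit :=
  for_each (iota 0 (w i)) (fun j => set_acc j 0) ;;
  let! r := read (@rep G) in
  for_each r (fun e =>
    let! y := op (gen i e.1) in
    let! j := op (hash P i y) in
    let! b := get_bucket i j in
    if bK b == Some y then
      let! j' := op (hash P (level e.1) e.1) in
      let! b' := get_bucket (level e.1) j' in
      let! a := get_acc j in
      set_acc j (a + bC b')
    else ret tt).

Definition detect_bucket (R : realType) (phi : R) (total : nat) i j : prog unit :=
  let! b := get_bucket i j in
  if bK b is Some x then
    let! e := estimate x i (lookahead P) in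
    if (phi * total%:R < e%:R :> R)%R then
      let! a := get_acc j in report x (e + a)
    else push x (bC b) i.+1
  else ret tt.

Definition detect (R : realType) (phi : R) (total : nat) : prog (seq (key G * nat)) :=
  clear_reports ;;
  for_each (iota 0 H) (fun i =>
    gather i ;;
    for_each (iota 0 (w i)) (detect_bucket phi total i)) ;;
  read (@rep G).

Definition feed (s : seq (key G * nat)) : prog unit := for_each s update.

Definition total_count (s : seq (key G * nat)) : nat := \sum_(p <- s) p.2.

Definition epoch (R : realType) (phi : R) (s : seq (key G * nat)) :
    outcome (seq (key G * nat)) :=
  (feed s ;; detect phi (total_count s)) (empty_memory G).

Definition after (s : seq (key G * nat)) : memory G := final (feed s (empty_memory G)).

Definition peak_space (R : realType) (phi : R) (s : seq (key G * nat)) : nat :=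
  peak (epoch phi s).

Definition update_time (s : seq (key G * nat)) (p : key G * nat) : nat :=
  cost (update p (after s)).

Definition detection_time (R : realType) (phi : R) (s : seq (key G * nat)) : nat :=
  cost (detect phi (total_count s) (after s)).

End Programs.

(* Values are arbitrary: packet counting is the case where they are all 1. *)
Definition is_stream (G : hierarchy) (s : seq (key G * nat)) : Prop :=
  forall p, p \in s -> level p.1 = 0.

Local Open Scope ring_scope.

Definition log2 (R : realType) (x : R) : R := ln x / ln 2.

(* t is a number of levels, so that t = log2 (1/delta) makes log2 (1/delta) a
   positive integer. *)
Record configured (R : realType) (G : hierarchy) (P : mvpipe G)
    (eps phi delta : R) : Prop := Configured {
  eps_gt0 : 0 < eps;
  eps_le_phi : eps <= phi;
  phi_lt1 : phi < 1;
  delta_gt0 : 0 < delta;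
  delta_lt1 : delta < 1;
  average_width :
    (\sum_(i < nodes G) width P i)%N%:R / (nodes G)%:R = 2 / eps;
  lookahead_eq : (lookahead P)%:R = log2 delta^-1;
  nodes_ge : log2 delta^-1 <= (nodes G)%:R
}.

(* Main.v *)
(* The running times hold because a Push visits each level at most once, while
   the buckets number W = 2 H / eps and at most W keys are reported; so Detect
   costs O(W H), and one of the two factors H is absorbed by d - 1 >= d / 2.

   The space needs a bound on the counters that does not involve W, since eps may
   be small compared with 1 / n.  It comes from conservation of counts: whatever
   is pushed past a level is either retained there as C or handed on to the next
   level, so that the V counters of a single level add up to at most the stream
   total S.  Detect respects this: the count of each bucket is either reported, in
   place, or pushed once, and levels already processed are never touched again.
   Hence all counters are at most S, and estimated counts at most 2 S. *)
Require Import Defs.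
From mathcomp Require Import all_boot all_order all_algebra.
From mathcomp Require Import reals exp.
From mathcomp Require Import zify ring lra.

Set Implicit Arguments.
Unset Strict Implicit.
Unset Printing Implicit Defensive.

Import Order.TTheory GRing.Theory Num.Theory.

Lemma level_gen (G : hierarchy) i (x : key G) :
  level x <= i < depth G -> level (gen i x) = i.
Proof.
case/andP=> xi iH; rewrite /gen -[RHS](subnKC xi).
have: level x + (i - level x) < depth G by rewrite subnKC.
elim: (i - level x) => [_|k IHk kH] /=; first by rewrite addn0.
rewrite addnS in kH *.
by rewrite level_parent IHk // ltnW.
Qed.

(** * Hoare triples with a cost budget and a space budget *)

Section Runs.
Context (G : hierarchy) (P : mvpipe G).
Implicit Types (m : memory G) (x y : key G) (i j l v b c S : nat).

Local Notation H := (nodes G).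
Local Notation w := (width P).

(** Costs add along [bind] whereas peaks combine by maximum, so [c] is split among subprograms while
    all of them share the same [b]. *)
Definition runs A b c (p : prog A) m (Q : A -> memory G -> Prop) : Prop :=
  [/\ Q (result (p m)) (final (p m)), cost (p m) <= c & peak (p m) <= b].

Lemma runs_weaken A b c c' (p : prog A) m (Q Q' : A -> memory G -> Prop) :
  c <= c' -> (forall a m', Q a m' -> Q' a m') ->
  runs b c p m Q -> runs b c' p m Q'.
Proof. by move=> cc' QQ' [/QQ' Qp cp bp]; split=> //; exact: leq_trans cc'. Qed.

Lemma runs_ret A b c (a : A) m (Q : A -> memory G -> Prop) :
  footprint P m <= b -> Q a m -> runs b c (ret P a) m Q.
Proof. by []. Qed.

Lemma runs_bind A B b c1 c2 (p : prog A) (f : A -> prog B) m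
    (Q : A -> memory G -> Prop) (Q' : B -> memory G -> Prop) :
  runs b c1 p m Q -> (forall a m', Q a m' -> runs b c2 (f a) m' Q') ->
  runs b (c1 + c2) (bind p f) m Q'.
Proof.
move=> [Qp cp bp] /(_ _ _ Qp)[Qf cf bf].
by split; rewrite //= ?leq_add // geq_max bp.
Qed.

Lemma runs_read A B b c (g : memory G -> A) (f : A -> prog B) m
    (Q : B -> memory G -> Prop) :
  footprint P m <= b -> runs b c (f (g m)) m Q ->
  runs b c.+1 (bind (read P g) f) m Q.
Proof. by move=> mb [Qf cf bf]; split; rewrite //= geq_max mb. Qed.

Lemma runs_op A B b c (a : A) (f : A -> prog B) m (Q : B -> memory G -> Prop) :
  footprint P m <= b -> runs b c (f a) m Q -> runs b c.+1 (bind (op P a) f) m Q.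
Proof. by move=> mb [Qf cf bf]; split; rewrite //= geq_max mb. Qed.

Lemma runs_write b c (g : memory G -> memory G) m (Q : unit -> memory G -> Prop) :
  footprint P m <= b -> footprint P (g m) <= b -> Q tt (g m) ->
  runs b c.+1 (write P g) m Q.
Proof. by move=> mb gmb Qg; split; rewrite //= geq_max mb. Qed.

(** The invariant is indexed by the list still to be processed; the successor on [c a] pays for the
    iteration itself. *)
Lemma runs_for_each A b (c : A -> nat) (body : A -> prog unit)
    (J : seq A -> memory G -> Prop) s m :
  (forall s m, J s m -> footprint P m <= b) ->
  (forall a s m, J (a :: s) m -> runs b (c a) (body a) m (fun _ => J s)) ->
  J s m ->
  runs b (\sum_(a <- s) (c a).+1) (for_each P s body) m (fun _ => J [::]).
Proof.
move=> Jb Jbody; elim: s m => [|a s IHs] m Jm /=; first exact: runs_ret (Jb _ _ Jm) _.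
rewrite big_cons addSn; apply: runs_op; first exact: Jb Jm.
by apply: runs_bind (Jbody _ _ _ Jm) _ => _; exact: IHs.
Qed.

Lemma runs_for_iota b (c : nat -> nat) (body : nat -> prog unit)
    (J : nat -> memory G -> Prop) n m :
  (forall k m, J k m -> footprint P m <= b) ->
  (forall k m, k < n -> J k m -> runs b (c k) (body k) m (fun _ => J k.+1)) ->
  J 0 m ->
  runs b (\sum_(k < n) (c k).+1) (for_each P (iota 0 n) body) m (fun _ => J n).
Proof.
move=> Jb Jbody J0.
(* The remaining list determines the number [k] of iterations done, which turns an invariant on
   lists into one on indices. *)
pose J' s m := exists2 k, s = iota k (n - k) /\ k <= n & J k m.
rewrite -(big_mkord xpredT (fun k => (c k).+1)) /index_iota subn0.
have J'b s m' : J' s m' -> footprint P m' <= b by case=> k _ /Jb.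
apply: (@runs_weaken _ _ _ _ _ _ (fun _ => J' [::])) (runs_for_each J'b _ _) => //.
- move=> _ m' [k [/(congr1 size)]]; rewrite size_iota /= => /esym/eqP.
  by rewrite subn_eq0 => nk kn; suff -> : k = n by []; apply/eqP; rewrite eqn_leq kn.
- move=> a s m' [k [+ kn]].
  case nk: (n - k) => [//|r] [-> ->] Jk.
  have ltkn : k < n by rewrite -subn_gt0 nk.
  apply: runs_weaken (Jbody k m' ltkn Jk) => // _ m'' Jm.
  by exists k.+1 => //; split=> //; congr iota; lia.
- by exists 0 => //; rewrite subn0.
Qed.

(** * Invariants of the memory and the bound on its footprint *)

Definition mass i (f : bucket G -> nat) m := \sum_(j < w i) f (arr m i j).

(* Pushing v at level l raises [load l i] by at most v: the levels l, ..., i - 1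
   retain as C what they do not hand on to level i. *)
Definition load l i m := mass i (@bV G) m + \sum_(l <= k < i) mass k (@bC G) m.

Definition sound_bucket i j (B : bucket G) : Prop :=
  [/\ bI B <= bV B, bC B <= bV B
    & forall x, bK B = Some x -> level x = i /\ hash P i x = j].

Definition total_width := \sum_(i < H) w i.

(** A reported value is an estimate plus an accumulator, each at most [S], whence [S.*2]. The bound
    on the number of reports reflects that each bucket is reported at most once. *)
Record sound S m : Prop := Sound {
  sound_buckets : forall i j, i < H -> j < w i -> sound_bucket i j (arr m i j);
  sound_mass : forall i, i < H -> mass i (@bV G) m <= S;
  sound_acc : forall j, acc m j <= S;
  sound_rep : forall r, r \in rep m -> r.2 <= S.*2;
  sound_size : size (rep m) <= total_width
}.

(** Per bucket: a key with its occupancy bit and three counters, to which are charged one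
    accumulator (as [max_width] is at most [total_width]) and one report, that is, a second key and
    a fifth count. *)
Definition space S :=
  total_width * ((nbits (max_key G)).*2.+1 + 5 * nbits S.*2).

Lemma le_mass m i j (f : bucket G -> nat) :
  j < w i -> f (arr m i j) <= mass i f m.
Proof. by move=> jw; rewrite /mass (bigD1 (Ordinal jw)) //= leq_addr. Qed.

Lemma bigmax_leq_sum n (F : 'I_n -> nat) : \max_(i < n) F i <= \sum_(i < n) F i.
Proof. by apply/bigmax_leqP => i _; rewrite (bigD1 i) //= leq_addr. Qed.

Lemma leq_nbits a b : a <= b -> nbits a <= nbits b.
Proof. by move=> ab; rewrite ltnS leq_trunc_log. Qed.

Lemma footprint_sound S m : sound S m -> footprint P m <= space S.
Proof.
move=> sm; have cntS : max_count P m <= S.*2.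
  have S2 : S <= S.*2 by rewrite -addnn leq_addr.
  rewrite /max_count !geq_max; apply/and3P; split.
  - apply/bigmax_leqP => i _; apply/bigmax_leqP => j _.
    have [IV CV _] := sound_buckets sm (ltn_ord i) (ltn_ord j).
    have VS : bV (arr m i j) <= S.*2.
      apply: leq_trans S2; apply: leq_trans (sound_mass sm (ltn_ord i)).
      exact: le_mass.
    by rewrite !geq_max VS (leq_trans IV VS) (leq_trans CV VS).
  - by apply/bigmax_leqP => j _; apply: leq_trans S2; exact: sound_acc sm _.
  - by apply/bigmax_leqP_seq => r rm _; exact: sound_rep sm _ rm.
have sz := sound_size sm.
have mw : max_width P <= total_width := bigmax_leq_sum (fun i : 'I_H => w i).
have cw := leq_nbits cntS.
rewrite /footprint /space -/total_width.
set kw := nbits (max_key G) in sz mw cw *.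
have e1 : total_width * (kw.+1 + 3 * nbits (max_count P m))
          <= total_width * (kw.+1 + 3 * nbits S.*2).
  by rewrite leq_mul2l leq_add2l leq_mul2l cw !orbT.
have e2 := leq_mul mw cw.
have e3 : size (rep m) * (kw + nbits (max_count P m)) <= total_width * (kw + nbits S.*2).
  by rewrite leq_mul // leq_add2l.
apply: leq_trans (leq_add (leq_add e1 e2) e3) _.
by rewrite -!mulnDr leq_mul2l; apply/orP; right; lia.
Qed.

(** * Push and the conservation of counts *)

Definition set_arr m i j (B : bucket G) : memory G :=
  Memory (fun i' j' => if (i' == i) && (j' == j) then B else arr m i' j')
         (rep m) (acc m).

Lemma runs_set_bucket A b c i j B (f : unit -> prog A) m (Q : A -> memory G -> Prop) :
  footprint P m <= b -> footprint P (set_arr m i j B) <= b ->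
  runs b c (f tt) (set_arr m i j B) Q ->
  runs b c.+1 (bind (set_bucket P i j B) f) m Q.
Proof. by move=> mb Bb [Qf cf bf]; split; rewrite //= !geq_max mb Bb. Qed.

(** Stated additively to avoid truncated subtraction. *)
Lemma mass_set_arr f m i j B :
  j < w i -> mass i f (set_arr m i j B) + f (arr m i j) = mass i f m + f B.
Proof.
move=> jw; rewrite /mass (bigD1 (Ordinal jw)) //= !eqxx /=.
rewrite [in RHS](bigD1 (Ordinal jw)) //=.
rewrite (eq_bigr (fun k : 'I_(w i) => f (arr m i k))); first lia.
by move=> k kj; rewrite ifN // eqxx.
Qed.

Lemma mass_set_arr_neq f m i j B k :
  k != i -> mass k f (set_arr m i j B) = mass k f m.
Proof. by move=> /negbTE ki; apply: eq_bigr => j' _; rewrite /= ki. Qed.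

Lemma eq_load l i m m' :
  (forall k, l <= k -> arr m' k =1 arr m k) -> l <= i -> load l i m' = load l i m.
Proof.
move=> mm' li; have eq_mass k f : l <= k -> mass k f m' = mass k f m.
  by move=> lk; apply: eq_bigr => j _; rewrite mm'.
by congr (_ + _); [exact: eq_mass|apply: eq_big_nat => k /andP[/eq_mass->]].
Qed.

Lemma loadS l i m : l < i -> load l i m = mass l (@bC G) m + load l.+1 i m.
Proof. by move=> li; rewrite /load big_ltn // addnCA. Qed.

Lemma load_id l m : load l l m = mass l (@bV G) m.
Proof. by rewrite /load big_geq // addn0. Qed.

(** Besides the growth of the load, this carries the frame conditions that Detect relies on: levels
    below [l], reports and accumulators stay as they were. *)
Definition pushed S l v m m' : Prop :=
  [/\ sound S m', forall i, l <= i < H -> load l i m' <= load l i m + v,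
      forall k, k < l -> arr m' k =1 arr m k, rep m' = rep m & acc m' = acc m].

Lemma pushed_refl S l m : sound S m -> pushed S l 0 m m.
Proof. by move=> sm; split=> // i _; rewrite addn0. Qed.

Lemma sound_set_arr S l j B m :
  l < H -> j < w l -> sound S m -> sound_bucket l j B ->
  mass l (@bV G) (set_arr m l j B) <= S -> sound S (set_arr m l j B).
Proof.
move=> lH jw sm sB VS; split=> /=.
- move=> i' j' iH jw'; case: andP => [[/eqP-> /eqP->]|_] //.
  exact: sound_buckets sm _ _ _ _.
- move=> i iH; have [->|il] := eqVneq i l; first by [].
  by rewrite mass_set_arr_neq //; exact: sound_mass sm _ _.
- exact: sound_acc sm.
- exact: sound_rep sm.
- exact: sound_size sm.
Qed.

(** For [i] above [l], what level [l] newly retains as C and the [v'] handed on add up to at most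
    [v]. An inequality is enough, and it also covers an empty bucket, whose C is not recorded as
    0. *)
Lemma pushed_step S l j B v v' m m' :
  l < H -> j < w l -> bV B = bV (arr m l j) + v ->
  bC B + v' <= bC (arr m l j) + v ->
  pushed S l.+1 v' (set_arr m l j B) m' -> pushed S l v m m'.
Proof.
move=> lH jw VB CB [sm' ld mm' rm am]; split=> // [i /andP[li iH]|k kl j'].
- have mf f : mass l f m' = mass l f (set_arr m l j B).
    by apply: eq_bigr => j' _; rewrite mm'.
  have [il|il] := eqVneq i l.
    have := mass_set_arr (@bV G) m B jw.
    by rewrite il !load_id mf VB; lia.
  have {}li : l < i by rewrite ltn_neqAle eq_sym il.
  have := mass_set_arr (@bC G) m B jw.
  have := ld i; rewrite li iH => /(_ isT).
  rewrite [X in _ <= X + _](@eq_load _ _ m) //; last first.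
    by move=> k lk j' /=; rewrite gtn_eqF.
  by rewrite !(loadS _ li) mf; lia.
- by rewrite mm' 1?ltnW //= ltn_eqF.
Qed.

(** Induction on the number of remaining levels. The hypothesis on [load] reserves room for [v] at
    every level the push may reach, which keeps each V mass within [S]. *)
Lemma runs_push S l x v m :
  l <= H -> (l < H -> level x <= l) -> sound S m ->
  (forall i, l <= i < H -> load l i m + v <= S) ->
  runs (space S) (5 * (H - l)) (push P x v l) m (fun _ => pushed S l v m).
Proof.
rewrite /push /levels_from => + + + +.
move n_def: (H - l) => n.
elim: n l n_def x v m => [|n IHn] l n_def x v m lH xl sm loadS' /=.
  apply: runs_ret; first exact: footprint_sound sm.
  split=> // [i /andP[li iH]]; have: 0 < H - l by rewrite subn_gt0 (leq_ltn_trans li).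
  by rewrite n_def.
have {}lH : l < H by rewrite -subn_gt0 n_def.
have yl : level (gen l x) = l by apply: level_gen; rewrite xl.
set y := gen l x in yl *.
have jw : hash P l y < w l by exact: hash_of_lt.
have fm := footprint_sound sm.
(* Five operations per level: iteration, generalization, hash, read, write. The budget is unfolded
   into successors, to be spent one by one. *)
rewrite mulnS; set c := 5 * n; rewrite !addSn add0n.
do 3!apply: runs_op => //.
apply: runs_read => //.
set B := arr m l (hash P l y).
have [IB CB KB] : sound_bucket l (hash P l y) B by exact: sound_buckets sm _ _ _ _.
have Bl x' : bK B = Some x' -> level x' = l by case/KB.
have loadl : mass l (@bV G) m + v <= S.
  by rewrite -load_id; apply: loadS'; rewrite leqnn lH.
have sound' B' : sound_bucket l (hash P l y) B' -> bV B' = bV B + v ->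
    sound S (set_arr m l (hash P l y) B').
  move=> sB' VB'; apply: sound_set_arr => //.
  by have := mass_set_arr (@bV G) m B' jw; rewrite VB' -/B; lia.
(* Decrementing and swapping both continue the loop and differ only in the new bucket and the pair
   handed on, so they are treated together. *)
have tail B' x' v' : sound_bucket l (hash P l y) B' -> level x' <= l ->
    bV B' = bV B + v -> bC B' + v' <= bC B + v ->
    runs (space S) c (push_loop P (iota l.+1 n) x' v') (set_arr m l (hash P l y) B')
      (fun _ => pushed S l v m).
  move=> sB' xl' VB' CB'; have sm' := sound' B' sB' VB'.
  apply: runs_weaken (IHn l.+1 _ x' v' _ lH _ sm' _) => //.
  - by move=> _ m'; exact: pushed_step.
  - by rewrite subnS n_def.
  - by move=> _; exact: leqW.
  move=> i /andP[li iH]; rewrite (@eq_load _ _ m) //; last first.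
    by move=> k lk j' /=; rewrite gtn_eqF.
  (* The count handed on is at most [v] plus the old C of this bucket, and that C is already
     included in [load l i m]. *)
  have := loadS' i; rewrite (ltnW li) iH => /(_ isT); rewrite loadS //.
  have := mass_set_arr (@bC G) m B' jw; have := le_mass m (@bC G) jw; rewrite -/B; lia.
case: eqP => [KBy|_].
  have sB' : sound_bucket l (hash P l y) (Bucket (bK B) (bV B + v) (bI B + v) (bC B + v)).
    by split; rewrite //= leq_add2r.
  have sm' := sound' _ sB' erefl.
  apply: runs_write; [by []|exact: footprint_sound sm'|].
  by apply: pushed_step (pushed_refl _ sm') => //=; rewrite addn0.
case: leqP => [vI|Iv].
  have sB' : sound_bucket l (hash P l y) (Bucket (bK B) (bV B + v) (bI B - v) (bC B)).
    by split=> //=; lia.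
  have sm' := sound' _ sB' erefl.
  apply: runs_set_bucket => //; first exact: footprint_sound sm'.
  by apply: tail; rewrite ?yl //=.
have sB' : sound_bucket l (hash P l y) (Bucket (Some y) (bV B + v) (v - bI B) v).
  by split=> /=; [lia|lia|move=> _ [<-]].
have sm' := sound' _ sB' erefl.
apply: runs_set_bucket => //; first exact: footprint_sound sm'.
case KBz: (bK B) => [z|].
  by apply: tail; rewrite ?(Bl z) //= addnC.
apply: runs_ret; first exact: footprint_sound sm'.
by apply: pushed_step (pushed_refl _ sm') => //=; rewrite addn0 leq_addl.
Qed.

Lemma sound_eq S m m' :
  arr m' = arr m -> rep m' = rep m -> (forall j, acc m' j <= S) ->
  sound S m -> sound S m'.
Proof.
move=> am rm accS sm; split=> //; rewrite ?rm ?am.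
- exact: sound_buckets sm.
- by rewrite /mass am; exact: sound_mass sm.
- exact: sound_rep sm.
- exact: sound_size sm.
Qed.

(** * Processing the stream *)

Lemma sound_empty S : sound S (empty_memory G).
Proof. by split=> //= i _; rewrite /mass big1. Qed.

(** [S] may exceed the total of [s], which leaves room for one further packet when the update time
    is measured. The loop invariant trades the load against the total of the packets still to
    come. *)
Lemma runs_feed S (s : seq (key G * nat)) :
  is_stream s -> total_count s <= S ->
  runs (space S) (\sum_(p <- s) (5 * H).+1) (feed P s) (empty_memory G)
    (fun _ m => sound S m /\ forall i, i < H -> load 0 i m <= total_count s).
Proof.
move=> str TS.
pose J (r : seq (key G * nat)) m := [/\ sound S m, {subset r <= s}
  & forall i, i < H -> load 0 i m + total_count r <= total_count s].
apply: (runs_weaken (leqnn _) _ (runs_for_each (J := J) (c := fun _ => 5 * H) _ _ _)).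
- move=> _ m [sm _ ld]; split=> // i /ld.
  by rewrite /total_count big_nil addn0.
- by move=> r m [/footprint_sound].
- move=> p r m [sm rs ld].
  have tot : total_count (p :: r) = p.2 + total_count r by rewrite /total_count big_cons.
  rewrite tot in ld.
  apply: runs_weaken (runs_push (l := 0) (v := p.2) _ _ sm _) => //.
  + by rewrite subn0.
  + move=> _ m' [sm' ld' _ _ _]; split=> // [q qr|i iH].
      by rewrite rs // inE qr orbT.
    by have := ld i iH; have := ld' i iH; lia.
  + by move=> _; rewrite str // rs // mem_head.
  + by move=> i /= iH; have := ld i iH; lia.
- split=> // [|i iH]; first exact: sound_empty.
  by rewrite /load /mass !big1 // => k _; rewrite big1.
Qed.

(** * Estimation *)

Lemma runs_estimate_loop b ls x v lo m :
  footprint P m <= b ->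
  runs b (4 * size ls) (estimate_loop P ls x v lo) m (fun e m' => e <= lo /\ m' = m).
Proof.
move=> mb; elim: ls v lo => [|i ls IHls] v lo /=; first exact: runs_ret.
rewrite mulnS; set c := 4 * _; rewrite !addSn add0n.
do 3!apply: runs_op => //.
apply: runs_read => //.
by case: ifP => _; apply: runs_weaken (IHls _ _) => // e m' [e_lo ->]; split=> //;
  apply: leq_trans e_lo (geq_minl _ _).
Qed.

(** The minimum is at most its first term (V + I) / 2, which is at most V since I <= V. The cost
    counts four operations for each of at most [H] levels, plus the initial hash and read. *)
Lemma runs_estimate S x l t m :
  l < H -> level x = l -> sound S m ->
  runs (space S) (4 * H + 2) (estimate P x l t) m (fun e m' => e <= S /\ m' = m).
Proof.
move=> lH xl sm; have fm := footprint_sound sm.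
rewrite /estimate addn2; apply: runs_op => //; apply: runs_read => //.
have jw : hash P l x < w l by exact: hash_of_lt.
have [IV _ _] := sound_buckets sm lH jw.
apply: runs_weaken (runs_estimate_loop _ _ _ _ fm); first by rewrite size_iota; lia.
move=> e m' [e_lo ->]; split=> //; apply: leq_trans e_lo _.
have := sound_mass sm lH; have := le_mass m (@bV G) jw; lia.
Qed.

(** * Detect *)

Definition reported_count m (r : key G * nat) :=
  bC (arr m (level r.1) (hash P (level r.1) r.1)).

(** The summands are the counts kept in the arrays, not the estimates [r.2]; only the former enter
    the conservation argument. *)
Definition reported_sum m := \sum_(r <- rep m) reported_count m r.

Lemma runs_gather S i m :
  i < H -> sound S m -> (forall r, r \in rep m -> level r.1 < i) ->
  reported_sum m <= S ->
  runs (space S) (2 * w i + (8 * total_width).+1) (gather P i) m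
    (fun _ m' => [/\ sound S m', arr m' = arr m & rep m' = rep m]).
Proof.
move=> iH sm ri sumS.
pose J1 k m' := [/\ arr m' = arr m, rep m' = rep m, forall j, acc m' j <= S
  & forall j, j < k -> acc m' j = 0].
have J1s k m' : J1 k m' -> sound S m' by case=> am rm aS _; exact: sound_eq sm.
apply: (runs_bind (Q := fun _ => J1 (w i))).
  have -> : 2 * w i = \sum_(k < w i) 1.+1 by rewrite sum_nat_const card_ord mulnC.
  apply: (runs_for_iota (J := J1) (c := fun _ => 1)).
  - by move=> k m' /J1s/footprint_sound.
  - move=> k m' kw Jm; have [am rm aS a0] := Jm.
    have Jm' : J1 k.+1 (Memory (arr m') (rep m') (fun j' => if j' == k then 0 else acc m' j')).
      split=> //= j; first by case: ifP.
      by rewrite ltnS leq_eqVlt; case: eqP => //= _; exact: a0.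
    by apply: runs_write => //; [exact: footprint_sound (J1s _ _ Jm)
      |exact: footprint_sound (J1s _ _ Jm')].
  - by split=> //; exact: sound_acc sm.
move=> _ m1 Jm1; have [am1 rm1 aS1 a01] := Jm1.
apply: runs_read; first exact: footprint_sound (J1s _ _ Jm1).
(* Each report adds its count to at most one accumulator. Charging all remaining reports to every
   accumulator gives a bound that starts from [reported_sum m]. *)
pose J2 (rs : seq (key G * nat)) m' := [/\ arr m' = arr m, rep m' = rep m,
  forall j, acc m' j <= S, {subset rs <= rep m}
  & forall j, j < w i -> acc m' j + \sum_(r <- rs) reported_count m r <= S].
have J2s rs m' : J2 rs m' -> sound S m' by case=> am rm aS _ _; exact: sound_eq sm.
apply: (@runs_weaken _ _ (\sum_(r <- rep m1) 8) _ _ _ (fun _ => J2 [::])).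
- by rewrite rm1 big_const_seq count_predT iter_addn_0 leq_mul2l (sound_size sm).
- by move=> _ m' Jm'; have [am rm _ _ _] := Jm'; split=> //; exact: J2s Jm'.
(* The longest branch has seven operations: one generalization, two hashes, two bucket reads, and a
   read and a write of [acc]. *)
apply: (runs_for_each (J := J2) (c := fun _ => 7)).
- by move=> rs m' /J2s/footprint_sound.
- move=> r rs m' Jm'; have [am rm aS rsm sumr] := Jm'.
  have fm' := footprint_sound (J2s _ _ Jm').
  have sub : {subset rs <= rep m} by move=> q qr; rewrite rsm // inE qr orbT.
  have {}sumr j : j < w i ->
      acc m' j + reported_count m r + \sum_(q <- rs) reported_count m q <= S.
    by move=> /sumr; rewrite big_cons addnA.
  have yi : level (gen i r.1) = i.
    by apply: level_gen; rewrite iH ltnW // ri // rsm // mem_head.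
  do 2!apply: runs_op => //.
  apply: runs_read => //.
  case: ifP => _; last first.
    by apply: runs_ret => //; split=> // j /sumr; lia.
  apply: runs_op => //.
  do 2!apply: runs_read => //.
  set j := hash P i (gen i r.1).
  have jw : j < w i by exact: hash_of_lt.
  rewrite am -/(reported_count m r).
  set a := acc m' j + reported_count m r.
  have Jm'' : J2 rs (Memory (arr m') (rep m') (fun j' => if j' == j then a else acc m' j')).
    split=> //= j'; case: eqP => [_|_]; rewrite ?aS //; last by move=> /sumr; lia.
      by have := sumr j jw; rewrite /a; lia.
    by rewrite sumr.
  by apply: runs_write => //; exact: footprint_sound (J2s _ _ Jm'').
- rewrite rm1; split=> // j jw; rewrite a01 //.
Qed.

(* The invariant of Detect before it processes level l. *)
Definition detected S l m : Prop :=
  [/\ sound S m, forall r, r \in rep m -> level r.1 < l,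
      size (rep m) <= \sum_(k < l) w k, reported_sum m <= S
    & forall i, l <= i < H -> reported_sum m + load l i m <= S].

Definition pending l j m := \sum_(j <= j' < w l) bC (arr m l j').

(* The invariant of Detect before it processes the bucket B(l, j). *)
Definition detecting S l j m : Prop :=
  [/\ sound S m, forall r, r \in rep m -> level r.1 <= l,
      size (rep m) <= \sum_(k < l) w k + j, reported_sum m + pending l j m <= S
    & forall i, l < i < H -> reported_sum m + pending l j m + load l.+1 i m <= S].

(** Initially all of the C mass of level [l] is pending. The clause without a load follows from C <=
    V; the others peel level [l] off the load. *)
Lemma detecting_start S l m : l < H -> detected S l m -> detecting S l 0 m.
Proof.
move=> lH [sm rl sz _ ld].
have pend : pending l 0 m = mass l (@bC G) m by rewrite /pending big_mkord.
split=> //; first by move=> r /rl/ltnW.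
- by rewrite addn0.
- have CV : mass l (@bC G) m <= mass l (@bV G) m.
    by apply: leq_sum => j _; case: (sound_buckets sm lH (ltn_ord j)).
  by have := ld l; rewrite load_id leqnn lH pend => /(_ isT); lia.
- move=> i /andP[li iH]; rewrite pend -addnA -loadS //.
  by apply: ld; rewrite ltnW.
Qed.

Lemma detecting_end S l m : detecting S l (w l) m -> detected S l.+1 m.
Proof.
rewrite /detecting /pending big_geq // !addn0 => -[sm rl sz sumS ld].
by split=> //; rewrite big_ord_recr.
Qed.

(** Processing a bucket removes its C from [pending]: a report moves it to [reported_sum], a push
    adds at most that much to the loads above. The cost is one read, an estimation and a push. *)
Lemma runs_detect_bucket S (R : realType) (phi : R) total l j m :
  l < H -> j < w l -> detecting S l j m ->
  runs (space S) (9 * H + 3) (detect_bucket P phi total l j) m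
    (fun _ => detecting S l j.+1).
Proof.
move=> lH jw [sm rl sz sumS ld]; have fm := footprint_sound sm.
have pend : pending l j m = bC (arr m l j) + pending l j.+1 m.
  by rewrite /pending big_ltn.
rewrite pend in sumS ld.
(* There is room for one more report because bucket [j] of level [l] has not been processed yet. *)
have szW : (size (rep m)).+1 <= total_width.
  apply: (@leq_trans (\sum_(k < l.+1) w k)).
    by rewrite big_ord_recr (leq_ltn_trans sz) ?ltn_add2l.
  rewrite /total_width -!(big_mkord xpredT w).
  by rewrite [leqRHS](big_cat_nat _ (n := l.+1)) //= leq_addr.
rewrite addn3; apply: runs_read => //.
case Kx: (bK (arr m l j)) => [x|]; last first.
  apply: runs_ret => //; split=> //; first lia.
    by lia.
  by move=> i /ld; lia.
have [_ _ /(_ x Kx)[xl xj]] := sound_buckets sm lH jw.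
apply: (@runs_weaken _ _ (4 * H + 2 + 5 * H)); [lia|by move=> u m'; exact|].
apply: runs_bind (runs_estimate _ lH xl sm) _ => e _ [eS ->].
case: ifP => _.
  apply: (@runs_weaken _ _ 2); [lia|by move=> u m'; exact|].
  apply: runs_read => //.
  pose m' := Memory (arr m) (rcons (rep m) (x, e + acc m j)) (acc m).
  have sm' : sound S m'.
    split=> /=; [exact: sound_buckets sm|exact: sound_mass sm|exact: sound_acc sm| |].
      move=> r; rewrite mem_rcons inE => /predU1P[->|/(sound_rep sm)//] /=.
      by have := sound_acc sm j; lia.
    by rewrite size_rcons.
  apply: runs_write => //; first exact: footprint_sound sm'.
  (* A stored key has level [l] and hashes to [j], so the count looked up for it is the C of this
     very bucket. *)
  have sum' : reported_sum m' = reported_sum m + bC (arr m l j).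
    by rewrite /reported_sum /= -cats1 big_cat big_seq1 /= /reported_count /= xl xj.
  split=> //.
  - by move=> r /=; rewrite mem_rcons inE => /predU1P[->|/rl//] /=; rewrite xl.
  - by rewrite /= size_rcons addnS ltnS.
  - by rewrite sum' -addnA.
  - by move=> i /ld; rewrite sum' -(addnA _ (bC _)).
apply: runs_weaken (runs_push (l := l.+1) (v := bC (arr m l j)) lH _ sm _).
- by rewrite leq_mul2l leq_subr orbT.
- move=> _ m' [sm' ld' am' rm' _].
  (* The push starts at level [l.+1], hence leaves the buckets of all reported keys and all pending
     buckets untouched. *)
  have sum' : reported_sum m' = reported_sum m.
    rewrite /reported_sum rm'; apply: eq_big_seq => r /rl rl'.
    by rewrite /reported_count am'.
  have pend' : pending l j.+1 m' = pending l j.+1 m.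
    by apply: eq_bigr => k _; rewrite am'.
  split; rewrite ?rm' ?sum' ?pend' //; try lia.
  by move=> i li; have := ld' i li; have := ld i li; lia.
- by rewrite xl.
- by move=> i /ld; lia.
Qed.

Lemma runs_detect S (R : realType) (phi : R) total m :
  sound S m -> (forall i, i < H -> load 0 i m <= S) ->
  runs (space S) (17 * (total_width * H) + 6 * total_width + 2 * H + 2)
    (detect P phi total) m (fun _ _ => True).
Proof.
move=> sm ld; have fm := footprint_sound sm.
have sm0 : sound S (Memory (arr m) [::] (acc m)).
  by split=> //; [exact: sound_buckets sm|exact: sound_mass sm|exact: sound_acc sm].
pose c i := 2 * w i + (8 * total_width).+1 + \sum_(j < w i) (9 * H + 3).+1.
apply: (@runs_weaken _ _ (1 + (\sum_(i < H) (c i).+1 + 1)) _ _ _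
  (fun _ _ => True)) => //; last first.
- apply: (runs_bind (Q := fun _ => detected S 0)).
    apply: runs_write => //; first exact: footprint_sound sm0.
    by split=> //=; rewrite /reported_sum /= big_nil.
  move=> _ m1 d1; apply: (runs_bind (Q := fun _ => detected S H)); last first.
    by move=> _ m2 [/footprint_sound fm2 _ _ _ _].
  apply: (runs_for_iota (J := detected S) (c := c)) => //.
    by move=> k m2 [/footprint_sound].
  move=> l m2 lH d2; have [sm2 rl sz sumS ld2] := d2.
  apply: (runs_bind (Q := fun _ => detected S l)).
    apply: runs_weaken (runs_gather lH sm2 rl sumS) => // _ m3 [sm3 am rm].
    have sum3 : reported_sum m3 = reported_sum m2.
      by rewrite /reported_sum rm /reported_count am.
    split=> //; rewrite ?rm ?sum3 // => i /ld2.
    by rewrite /load /mass am.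
  move=> _ m3 d3; apply: runs_weaken (leqnn _) (fun _ _ => @detecting_end S l _) _.
  apply: (runs_for_iota (J := detecting S l) (c := fun _ => 9 * H + 3)).
  - by move=> k m4 [/footprint_sound].
  - by move=> k m4 kw; exact: runs_detect_bucket.
  - exact: detecting_start.
(* The coefficient 17 is 9 from estimation and push in every bucket, plus 8 from going through at
   most [total_width] reports at every level. *)
- rewrite /c; under eq_bigr do rewrite sum_nat_const card_ord.
  have -> : \sum_(i < H) (2 * w i + (8 * total_width).+1 + w i * (9 * H + 3).+1).+1
      = \sum_(i < H) (w i * (9 * H + 6) + (8 * total_width + 2)).
    by apply: eq_bigr => i _; lia.
  by rewrite big_split /= -big_distrl /= -/total_width sum_nat_const card_ord; lia.
Qed.

End Runs.

Local Open Scope ring_scope.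

(** * Real-valued bounds and the constants *)

Lemma log2_ge1 (R : realType) n : (1 < n)%N -> 1 <= log2 n%:R :> R.
Proof.
move=> n1; have ln2 : 0 < ln 2 :> R by rewrite ln_gt0 // ltr1n.
rewrite /log2 ler_pdivlMr // mul1r ler_ln ?posrE ?ler_nat ?ltr0n //.
exact: ltnW.
Qed.

(** The extra digit beyond the truncated logarithm is absorbed by one more [log2 n], which is at
    least 1; this accounts for [k.+1]. *)
Lemma nbits_le (R : realType) n k a :
  (1 < n)%N -> (a <= n ^ k)%N -> (nbits a)%:R <= k.+1%:R * log2 n%:R :> R.
Proof.
move=> n1 /leq_nbits nk; have ln2 : 0 < ln 2 :> R by rewrite ln_gt0 // ltr1n.
have n0 : (0 < n)%N by exact: ltnW.
apply: (@le_trans _ _ (nbits (n ^ k))%:R); first by rewrite ler_nat.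
rewrite -addn1 natrD mulrDl mul1r /nbits -addn1 natrD.
rewrite lerD ?log2_ge1 // /log2 mulrA ler_pdivlMr // !mulr_natl -!lnXn ?ltr0n //.
rewrite ler_ln ?posrE ?exprn_gt0 ?ltr0n // -!natrX ler_nat.
by rewrite trunc_logP // expn_gt0 n0.
Qed.

Lemma nodes_gt0 (G : hierarchy) : (0 < nodes G)%N.
Proof. exact: leq_ltn_trans (level_lt (top_key G)). Qed.

Section Configured.
Context (R : realType) (G : hierarchy) (P : mvpipe G) (eps phi delta : R)
  (conf : configured P eps phi delta).

Lemma total_widthE : (total_width P)%:R = 2 * ((nodes G)%:R / eps) :> R.
Proof.
have H0 : (nodes G)%:R != 0 :> R by rewrite pnatr_eq0 -lt0n nodes_gt0.
by rewrite -[LHS](divfK H0) (average_width conf) mulrAC mulrA.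
Qed.

(** From [eps <= phi < 1] the average width 2 / eps is at least 1. This absorbs the lower-order
    terms of the detection cost. *)
Lemma nodes_le_width : (nodes G <= total_width P)%N.
Proof.
have e0 := eps_gt0 conf.
have e1 : eps <= 1 := le_trans (eps_le_phi conf) (ltW (phi_lt1 conf)).
rewrite -(ler_nat R) total_widthE mulrA ler_pdivlMr //.
have : (0 : R) <= (nodes G)%:R by [].
nra.
Qed.

(** The logarithm is positive and, being equal to the natural number [lookahead P], is at least 1.
    It can thus be inserted as a factor in the detection bound. *)
Lemma lookahead_ge1 : 1 <= log2 delta^-1.
Proof.
rewrite -(lookahead_eq conf) ler1n -(ltr0n R) (lookahead_eq conf).
rewrite divr_gt0 ?ln_gt0 ?ltr1n // invf_gt1 ?(delta_lt1 conf) //.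
exact: delta_gt0 conf.
Qed.

Lemma peak_space_le kappa (s : seq (key G * nat)) :
  is_stream s -> (1 < max_key G)%N -> (total_count s <= max_key G ^ kappa)%N ->
  (peak_space P phi s)%:R
    <= (5 * kappa + 15)%:R * 2 * ((nodes G)%:R / eps * log2 (max_key G)%:R).
Proof.
move=> str n1 Sn; set L := log2 _.
have [[sm ld] _ feed_peak] := runs_feed P str (leqnn _).
have [_ _ detect_peak] := runs_detect phi (total_count s) sm ld.
have peakS : (peak_space P phi s <= space P (total_count s))%N.
  by rewrite /peak_space /epoch /= geq_max feed_peak.
apply: (@le_trans _ _ (space P (total_count s))%:R); first by rewrite ler_nat.
rewrite /space natrM total_widthE.
rewrite [leRHS](_ : _ = 2 * ((nodes G)%:R / eps) * ((5 * kappa + 15)%:R * L)); last by ring.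
rewrite ler_wpM2l ?mulr_ge0 ?invr_ge0 ?(ltW (eps_gt0 conf)) //.
have L1 : 1 <= L := log2_ge1 R n1.
have kw : (nbits (max_key G))%:R <= 2%:R * L.
  by apply: nbits_le; rewrite ?expn1.
(* Doubling the total costs one more factor of the largest key. Together, 2 * 2 + 1 + 5 * (kappa +
   2) = 5 * kappa + 15. *)
have cw : (nbits (total_count s).*2)%:R <= kappa.+2%:R * L.
  by apply: nbits_le; rewrite // expnS -mul2n leq_mul.
rewrite natrD -natr1 -muln2 !natrM [(5 * kappa + 15)%:R]natrD natrM.
rewrite -[kappa.+2]addn2 natrD in cw.
lra.
Qed.

Lemma update_time_le (s : seq (key G * nat)) (p : key G * nat) :
  is_stream (rcons s p) -> (update_time P s p)%:R <= 5 * (nodes G)%:R :> R.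
Proof.
move=> str; have str_s : is_stream s.
  by move=> q qs; apply: str; rewrite mem_rcons inE qs orbT.
have tot : total_count (rcons s p) = (total_count s + p.2)%N.
  by rewrite /total_count -cats1 big_cat big_seq1.
(* The bound [S] is the total including the new packet [p], so that pushing it preserves
   soundness. *)
have TS : (total_count s <= total_count (rcons s p))%N by rewrite tot leq_addr.
have [[sm ld] _ _] := runs_feed P str_s TS.
have [||_ + _] := runs_push (l := 0) (x := p.1) (v := p.2) (leq0n _) _ sm _.
- by move=> _; rewrite str // mem_rcons mem_head.
- by move=> i /= iH; rewrite tot leq_add2r ld.
by rewrite subn0 -(ler_nat R) natrM.
Qed.

Lemma detection_time_le (s : seq (key G * nat)) :
  is_stream s -> (1 < depth G)%N ->
  (detection_time P phi s)%:R
    <= 108 * ((nodes G)%:R * ((depth G)%:R - 1) / eps * log2 delta^-1).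
Proof.
move=> str d1; have [[sm ld] _ _] := runs_feed P str (leqnn _).
have [_ + _] := runs_detect phi (total_count s) sm ld.
rewrite -/(detection_time P phi s) => cost_le.
have HW := nodes_le_width; have H0 := nodes_gt0 G.
(* With W >= H >= 1, each of the terms W, H and 1 is at most W * H, and 17 + 6 + 2 + 2 = 27. *)
have {}cost_le : (detection_time P phi s <= 27 * (total_width P * nodes G))%N.
  apply: leq_trans cost_le _; nia.
apply: (@le_trans _ _ (27 * (total_width P * nodes G))%N%:R); first by rewrite ler_nat.
rewrite !natrM total_widthE.
have d2 : (2 : R) <= (depth G)%:R by rewrite ler_nat.
have e0 : 0 <= eps^-1 by rewrite invr_ge0 (ltW (eps_gt0 conf)).
rewrite /nodes; set D := (depth G)%:R in d2 *.
have DE : 0 <= D / eps by rewrite mulr_ge0 //; lra.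
(* The factor 2 of the total width gives 54, and D <= 2 * (D - 1) for D >= 2 doubles it. *)
apply: (@le_trans _ _ (108 * (D * (D - 1) / eps))).
  have D2 : 0 <= D - 2 by lra.
  have := mulr_ge0 DE D2; lra.
rewrite ler_wpM2l // ler_peMr ?lookahead_ge1 //.
by rewrite mulrAC mulr_ge0 //; lra.
Qed.

End Configured.

Theorem theorem1 (R : realType) :
  [/\ (* space, in bits, for counts polynomial in the largest key value n > 1 *)
      forall kappa : nat, exists c : R,
      forall (G : hierarchy) (P : mvpipe G) (eps phi delta : R)
             (s : seq (key G * nat)),
        configured P eps phi delta -> is_stream s ->
        (1 < max_key G)%N -> (total_count s <= max_key G ^ kappa)%N ->
        (peak_space P phi s)%:R
          <= c * ((nodes G)%:R / eps * log2 (max_key G)%:R),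
      (* update time *)
      exists c : R,
      forall (G : hierarchy) (P : mvpipe G) (eps phi delta : R)
             (s : seq (key G * nat)) (p : key G * nat),
        configured P eps phi delta -> is_stream (rcons s p) ->
        (update_time P s p)%:R <= c * (nodes G)%:R
    & (* detection time, for a hierarchy with at least two levels *)
      exists c : R,
      forall (G : hierarchy) (P : mvpipe G) (eps phi delta : R)
             (s : seq (key G * nat)),
        configured P eps phi delta -> is_stream s ->
        (1 < depth G)%N ->
        (detection_time P phi s)%:R
          <= c * ((nodes G)%:R * ((depth G)%:R - 1) / eps * log2 delta^-1)].
Proof.
split=> [kappa||].
- exists ((5 * kappa + 15)%:R * 2) => G P eps phi delta s conf.
  exact: peak_space_le conf _ _.
- by exists 5 => G P eps phi delta s p conf; exact: update_time_le.
- by exists 108 => G P eps phi delta s conf; exact: detection_time_le conf _.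
Qed.
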